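(* Let $m\ge1$, $k\ge2$, let $R\in\mathbb{Z}_{2^k}^{m\times m}$ be symmetric, $v\in\mathbb{Z}_2^m$, and let $a,b\in\mathbb{Z}^m$ with binary expansions $a=a_0+2a_1+4a_2+\cdots$, $b=b_0+2b_1+4b_2+\cdots$, where $a_i,b_i\in\{0,1\}^m$. Then $$\left(\tau_R^{(k)}E(a,b)(\tau_R^{(k)})^\dagger\right)e_v=\xi^{q^{(k-1)}(v;R,a,b)}\,E([a_0,b_0]\Gamma_R)\,e_v=\xi^{q^{(k-1)}(v;R,a,b)}\,E(a_0,\,b_0+a_0R)\,e_v,$$ where $\xi=\exp(2\pi\imath/2^k)$, $\Gamma_R=\begin{bmatrix}I_m&R\\0&I_m\end{bmatrix}\in\mathbb{Z}_{2^k}^{2m\times2m}$ and $$q^{(k-1)}(v;R,a,b)=(1-2^{k-2})\,a_0Ra_0^T+2^{k-1}(a_0b_1^T+b_0a_1^T)+(2+2^{k-1})\,vRa_0^T-4\,\eta(v;R,a_0).$$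
   Context: Let $N=2^m$, with standard basis $e_v=|v\rangle$ of $\mathbb{C}^N=(\mathbb{C}^2)^{\otimes m}$ indexed by row vectors $v\in\{0,1\}^m=\mathbb{Z}_2^m$, and $\imath=\sqrt{-1}$. Let $X=\begin{bmatrix}0&1\\1&0\end{bmatrix}$, $Z=\begin{bmatrix}1&0\\0&-1\end{bmatrix}$. For integer row vectors $x,y\in\mathbb{Z}^m$ put $D(x,y)=X^{x_1}Z^{y_1}\otimes\cdots\otimes X^{x_m}Z^{y_m}$ and $E(x,y)=\imath^{xy^T\bmod4}D(x,y)$, where $xy^T=\sum_ix_iy_i$ is computed over $\mathbb{Z}$; $E(x,y)$ depends only on $x,y$ modulo $4$. We write $E([x,y])=E(x,y)$. $\tau_R^{(k)}=\sum_{v\in\mathbb{Z}_2^m}\xi^{vRv^T\bmod2^k}|v\rangle\langle v|$, with entries of $v$ regarded as integers $0,1$. For $v,w\in\{0,1\}^m$, $v\ast w=[v_1w_1,\dots,v_mw_m]$ is the entrywise product and $\eta(v;R,w)=[(v+w)-(v\ast w)]\,R\,(v\ast w)^T$, with sums taken in $\mathbb{Z}_{2^k}$ (not modulo $2$). Entries of $R$ may be represented by integers: exponents of $\xi$ are read modulo $2^k$; since $k\ge2$, $E(a_0,b_0+a_0R)$ is well defined. Only the digits $a_0,a_1,b_0,b_1$, determined by $a\equiv a_0+2a_1$ and $b\equiv b_0+2b_1\pmod4$, matter. *)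

(* Defs.v *)
From HB Require Import structures.
From mathcomp Require Import all_boot all_order all_algebra.
From mathcomp Require Import sesquilinear spectral complex.
From mathcomp Require Import reals sequences exp trigo.
From mathcomp Require Import zify ring.

Set Implicit Arguments.
Unset Strict Implicit.
Unset Printing Implicit Defensive.

Import Order.TTheory GRing.Theory Num.Theory.
Local Open Scope sesquilinear_scope.
Local Open Scope ring_scope.
Local Open Scope complex_scope.

Section ComplexExponential.
Variable K : realType.

Definition cexp (z : K[i]) : K[i] :=
  (expR (complex.Re z))%:C * (cos (complex.Im z) +i* sin (complex.Im z)).

Definition xi (k : nat) : K[i] := cexp (2%:R * (@pi K)%:C * 'i%C / 2%:R ^+ k).

End ComplexExponential.

(* {0,1}^m is the type 'rV['Z_2]_m; liftmx reads the entries of a matrix of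
   residues as the natural numbers 0, ..., n - 1 and maps these to S (here int
   or 'Z_(2 ^ k)). It is not additive. *)
Definition liftmx (S : pzRingType) (n p m : nat) (A : 'M['Z_n]_(p, m)) :
  'M[S]_(p, m) := map_mx (fun z : 'Z_n => (z : nat)%:R) A.

(* [digit j a] is the vector a_j of the 2-adic expansion a_0 + 2 a_1 + 4 a_2 ...
   of a; %/ rounds towards -oo, so this also covers negative entries. *)
Definition digit (m j : nat) (a : 'rV[int]_m) : 'rV['Z_2]_m :=
  map_mx (fun z : int => (z %/ 2 ^+ j)%Z%:~R) a.

Lemma digit_expansion m n (a : 'rV[int]_m) (l : 'I_m) :
  let z := a 0 l in
  (z = (\sum_(j < n) 2 ^+ j * liftmx int (digit j a) 0 l)%R %[mod 2 ^+ n])%Z.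
Proof.
move=> z; suff -> : z = \sum_(j < n) 2 ^+ j * liftmx int (digit j a) 0 l
                  + (z %/ 2 ^+ n)%Z * 2 ^+ n by rewrite addrC modzMDl.
elim: n => [|n IH]; first by rewrite big_ord0 expr0 divz1 mulr1 add0r.
rewrite big_ord_recr /= {1}IH -addrA; congr (_ + _).
rewrite !mxE -/z.
have hq : (z %/ 2 ^+ n.+1)%Z = ((z %/ 2 ^+ n)%Z %/ 2)%Z.
  by rewrite exprSr divzMA_ge0 ?exprn_ge0.
rewrite hq; set y := (z %/ 2 ^+ n)%Z.
suff -> : ((y%:~R : 'Z_2) : nat)%:R = (y %% 2)%Z :> int.
  have := divz_eq y 2; move: (y %/ 2)%Z (y %% 2)%Z => c d ->; rewrite exprS; ring.
rewrite {1}(divz_eq y 2) intrD intrM (_ : (2%:~R : 'Z_2) = 0) ?mulr0 ?add0r; last exact/val_inj.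
have := modz_ge0 y (isT : 2 != 0 :> int); have := ltz_pmod y (isT : 0 < 2 :> int).
by case: (y %% 2)%Z => [[|[|]]|].
Qed.

Section Operators.
Variable K : realType.
Local Notation C := K[i].

(* The coordinates of C^N are indexed, through enum_rank, by {0,1}^m itself. *)
Definition dimN (m : nat) : nat := #|{: 'rV['Z_2]_m}|.

Lemma dimNE m : dimN m = (2 ^ m)%N.
Proof. by rewrite /dimN card_mx card_ord mul1n. Qed.

Definition ket (m : nat) (v : 'rV['Z_2]_m) : 'cV[C]_(dimN m) :=
  delta_mx (enum_rank v) 0.

(* A_1 (x) ... (x) A_m in the basis |v> = |v_1> (x) ... (x) |v_m>. *)
Definition tensor (m : nat) (A : 'I_m -> 'M[C]_2) : 'M[C]_(dimN m) :=
  \matrix_(i, j)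
    \prod_(l < m) A l ((enum_val i : 'rV['Z_2]_m) 0 l)
                      ((enum_val j : 'rV['Z_2]_m) 0 l).

Definition pauliX : 'M[C]_2 := \matrix_(i, j) (i != j)%:R.
Definition pauliZ : 'M[C]_2 := \matrix_(i, j) ((-1) ^+ i *+ (i == j)).

Definition D (m : nat) (x y : 'rV[int]_m) : 'M[C]_(dimN m) :=
  tensor (fun l => pauliX ^ x 0 l * pauliZ ^ y 0 l).

Definition E (m : nat) (x y : 'rV[int]_m) : 'M[C]_(dimN m) :=
  let s := (x *m y^T) 0 0 in 'i%C ^ (s %% 4)%Z *: D x y.

(* E on vectors with entries in Z_(2^k), evaluated at the representatives in
   [0, 2^k[; by EmodE below any other representatives give the same matrix when
   2 <= k. *)
Definition Emod (k m : nat) (x y : 'rV['Z_(2 ^ k)]_m) : 'M[C]_(dimN m) :=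
  E (liftmx int x) (liftmx int y).

Definition Erow (k m : nat) (u : 'rV['Z_(2 ^ k)]_(m + m)) : 'M[C]_(dimN m) :=
  Emod (lsubmx u) (rsubmx u).

(* xi has order 2^k, so its exponents are the representatives in [0, 2^k[ of
   residues, through the coercion of 'Z_(2 ^ k) to nat. *)
Definition tau (k m : nat) (R : 'M['Z_(2 ^ k)]_m) : 'M[C]_(dimN m) :=
  \sum_(v : 'rV['Z_2]_m)
    xi K k ^+ ((liftmx 'Z_(2 ^ k) v *m R *m (liftmx 'Z_(2 ^ k) v)^T) 0 0)
      *: (ket v *m (ket v)^t*).

End Operators.

Lemma pauliX2 (K : realType) : pauliX K * pauliX K = 1.
Proof.
apply/matrixP => i j; rewrite !mxE !big_ord_recl big_ord0 !mxE.
by case: i => [[|[|i]] ?] //; case: j => [[|[|j]] ?] //; rewrite -?val_eqE /= ?mulr0 ?mulr1 ?mul0r ?addr0 ?add0r.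
Qed.

Lemma pauliZ2 (K : realType) : pauliZ K * pauliZ K = 1.
Proof.
apply/matrixP => i j; rewrite !mxE !big_ord_recl big_ord0 !mxE.
by case: i => [[|[|i]] ?] //; case: j => [[|[|j]] ?] //; rewrite -?val_eqE /= ?mulr0n ?mulr1n ?expr0 ?expr1 ?mulr0 ?mul0r ?mulrNN ?mulr1 ?addr0 ?add0r.
Qed.

Lemma exprz_modM (A : unitRingType) (g : A) (p : nat) (x x' : int) :
  (0 < p)%N -> g ^+ p = 1 -> (x = x' %[mod p])%Z -> g ^ x = g ^ x'.
Proof.
move=> p0 gp h.
have gu : g \is a GRing.unit.
  by rewrite -(unitrX_pos _ p0) gp unitr1.
have H z : g ^ z = g ^ (z %% p)%Z.
  by rewrite {1}(divz_eq z p) exprzDr // [X in g ^ X * _]mulrC -exprz_exp [X in X ^ _]gp exp1rz mul1r.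
by rewrite H h -H.
Qed.

Lemma dvd4_2 x x' : (x = x' %[mod 4])%Z -> (x = x' %[mod 2])%Z.
Proof. lia. Qed.

Lemma E_mod4 (K : realType) m (x x' y y' : 'rV[int]_m) :
  (forall l, (x 0%R l = x' 0%R l %[mod 4])%Z) ->
  (forall l, (y 0%R l = y' 0%R l %[mod 4])%Z) -> E K x y = E K x' y'.
Proof.
move=> hx hy; rewrite /E; congr (_ *: _).
  congr exprz; rewrite !mxE.
  elim/big_rec2: _ => // l s s' _ h.
  by rewrite -modzDm !mxE -modzMm hx hy h modzMm modzDm.
rewrite /D /tensor; apply/matrixP => i j; rewrite !mxE; apply: eq_bigr => l _.
rewrite (exprz_modM (isT : (0 < 2)%N) (pauliX2 K) (dvd4_2 (hx l))).
by rewrite (exprz_modM (isT : (0 < 2)%N) (pauliZ2 K) (dvd4_2 (hy l))).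
Qed.

Lemma EmodE (K : realType) k m (x y : 'rV[int]_m) : (2 <= k)%N ->
  let red (u : 'rV[int]_m) := map_mx (fun z => z%:~R : 'Z_(2 ^ k)) u in
  Emod K (red x) (red y) = E K x y.
Proof.
move=> hk red; have k4 : (4 %| 2 ^ k)%N by rewrite (@dvdn_exp2l 2 2 k).
have k1 : (1 < 2 ^ k)%N by apply: leq_trans (dvdn_leq _ k4); rewrite ?expn_gt0.
have H (z : int) : (((z%:~R : 'Z_(2 ^ k)) : nat)%:R = z %[mod 4])%Z.
  have n0 : ((2 ^ k)%N : int) != 0 by rewrite -lt0n ltnW.
  have -> : (z%:~R : 'Z_(2 ^ k)) = (absz (z %% (2 ^ k)%N)%Z)%:R.
    rewrite {1}(divz_eq z (2 ^ k)%N) intrD intrM -[X in _ * X]/(((2 ^ k)%N)%:R) pchar_Zp // mulr0 add0r.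
    by rewrite -{1}(gez0_abs (modz_ge0 z n0)).
  rewrite val_Zp_nat // modn_small; last first.
    by rewrite -ltz_nat gez0_abs ?modz_ge0 // ltz_pmod // ltz_nat ltnW.
  rewrite natz gez0_abs ?modz_ge0 // [in RHS](divz_eq z (2 ^ k)%N).
  by case/dvdnP: k4 => c ->; rewrite PoszM mulrA modzMDl.
by apply: E_mod4 => l; rewrite !mxE H.
Qed.

Section Exponents.
Variables (k m : nat).
Local Notation Zk := ('Z_(2 ^ k)).
Implicit Types (R : 'M[Zk]_m) (v w : 'rV['Z_2]_m) (a b : 'rV[int]_m).

Definition Gamma R : 'M[Zk]_(m + m) := block_mx 1%:M R 0 1%:M.

Definition star (u w : 'rV[Zk]_m) : 'rV[Zk]_m := map2_mx *%R u w.

Definition eta v R w : Zk :=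
  let V := liftmx Zk v in
  let W := liftmx Zk w in
  ((V + W - star V W) *m R *m (star V W)^T) 0 0.

Definition q v R a b : Zk :=
  let V := liftmx Zk v in
  let a0 := liftmx Zk (digit 0 a) in
  let a1 := liftmx Zk (digit 1 a) in
  let b0 := liftmx Zk (digit 0 b) in
  let b1 := liftmx Zk (digit 1 b) in
  (1 - 2%:R ^+ (k - 2)) * (a0 *m R *m a0^T) 0 0
  + 2%:R ^+ (k - 1) * (a0 *m b1^T + b0 *m a1^T) 0 0
  + (2%:R + 2%:R ^+ (k - 1)) * (V *m R *m a0^T) 0 0
  - 4%:R * eta v R (digit 0 a).

End Exponents.

(* Main.v *)
Require Import Defs.
From mathcomp Require Import all_boot all_order all_algebra.
From mathcomp Require Import sesquilinear spectral complex reals.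
From mathcomp Require Import exp trigo.
From mathcomp Require Import ring zify.

(* Everything is monomial in the basis |v>. Since xi^(2^(k-2)) = i and
   xi^(2^(k-1)) = -1, all phases are values of the additive character
   chi z = xi^z of Z_(2^k):
     E(x,y)|v> = chi (2^(k-2) x y^T + 2^(k-1) v y^T) |v + x mod 2>,
     tau_R |v> = chi (v R v^T) |v>.
   The theorem thus reduces to an identity between exponents in Z_(2^k). The
   term eta comes from writing v + a_0 mod 2 over the integers as
   v + a_0 - 2 (v * a_0) and expanding the quadratic form R there. *)

Set Implicit Arguments.
Unset Strict Implicit.
Unset Printing Implicit Defensive.

Import GRing.Theory Num.Theory.
Local Open Scope sesquilinear_scope.
Local Open Scope ring_scope.

(** * Powers of [xi] as points of the unit circle *)

Section RootOfUnity.
Variable K : realType.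
Local Notation C := (complex K).

Definition cis (t : K) : C := Complex (cos t) (sin t).

Lemma cisD s t : cis (s + t) = cis s * cis t.
Proof.
rewrite /cis cosD sinD; apply/eqP.
by rewrite eq_complex /= [cos s * sin t + _]addrC !eqxx.
Qed.

Lemma cisX t n : cis t ^+ n = cis (t *+ n).
Proof.
elim: n => [|n IH]; first by rewrite /cis mulr0n cos0 sin0.
by rewrite exprS IH -cisD -mulrS.
Qed.

Lemma cis_conj t : (cis t)^* * cis t = 1.
Proof.
rewrite mulrC -normCK; apply/eqP.
rewrite /cis normc_def /= cos2Dsin2 sqrtr1.
by rewrite expr1n.
Qed.

(** With a real angle, powers become multiples of the angle and conjugation becomes inversion; the
    quarter power then sits at angle pi/2. *)
Lemma xiE k : xi K k = cis (pi *+ 2 / 2 ^+ k).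
Proof.
rewrite /xi /cexp.
have -> : 2 * (real_complex K pi) * 'i%C / 2 ^+ k
          = Complex 0 (pi *+ 2 / 2 ^+ k) :> C.
  have -> : (2 ^+ k : C)^-1 = real_complex K (2 ^+ k)^-1.
    by rewrite fmorphV rmorphXn /= rmorph_nat.
  rewrite -mulr_natl.
  by apply/eqP; rewrite eq_complex /=; apply/andP; split; apply/eqP; ring.
by rewrite /= expR0 rmorph1 mul1r.
Qed.

Lemma xi_quarter k : (2 <= k)%N -> xi K k ^+ (2 ^ (k - 2)) = 'i%C.
Proof.
move=> hk; rewrite xiE cisX.
suff -> : (pi *+ 2 / 2 ^+ k) *+ 2 ^ (k - 2) = (pi : K) / 2.
  by rewrite /cis cos_pihalf sin_pihalf.
rewrite -{1}(subnK hk) exprD -mulr_natr natrX.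
field.
by rewrite expf_neq0 // pnatr_eq0.
Qed.

Lemma xi_half k : (2 <= k)%N -> xi K k ^+ (2 ^ (k - 1)) = -1.
Proof.
move=> hk; have -> : (2 ^ (k - 1) = 2 ^ (k - 2) * 2)%N.
  by rewrite -expnSr; congr expn; lia.
by rewrite exprM xi_quarter // complexiE sqrCi.
Qed.

Lemma xi_order k : (2 <= k)%N -> xi K k ^+ (2 ^ k) = 1.
Proof.
move=> hk; have -> : (2 ^ k = 2 ^ (k - 1) * 2)%N.
  by rewrite -expnSr; congr expn; lia.
by rewrite exprM xi_half // sqrrN expr1n.
Qed.

End RootOfUnity.

(** * The additive character z -> xi^z of Z_(2^k) *)

Section Character.
Variables (K : realType) (k : nat).
Hypothesis hk : (2 <= k)%N.
Local Notation Zk := 'Z_(2 ^ k).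

(** The exponent is the representative of [z] in [0, 2^k[, so additivity is not automatic: it rests
    on [xi_order]. *)
Definition chi (z : Zk) : K[i]%C := xi K k ^+ z.

Lemma modulus_gt1 : (1 < 2 ^ k)%N.
Proof. by rewrite -{1}(expn0 2) ltn_exp2l //; lia. Qed.

Lemma chi_nat n : chi n%:R = xi K k ^+ n.
Proof. by rewrite /chi val_Zp_nat ?modulus_gt1 // expr_mod // xi_order. Qed.

Lemma chiD x y : chi (x + y) = chi x * chi y.
Proof. by rewrite -[x]natr_Zp -[y]natr_Zp -natrD !chi_nat exprD. Qed.

Lemma chi0 : chi 0 = 1.
Proof. by []. Qed.

Lemma chiN x : chi (- x) = (chi x)^-1.
Proof.
have h : chi x * chi (- x) = 1 by rewrite -chiD subrr chi0.
have nz : chi x != 0 by apply: contra_eq_neq h => ->; rewrite mul0r eq_sym oner_eq0.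
by apply: (mulfI nz); rewrite h divff.
Qed.

(** Powers of [xi] have modulus 1, so conjugation inverts them; hence the adjoint of [tau]
    contributes the opposite exponent. *)
Lemma chi_conj x : (chi x)^* = chi (- x).
Proof.
have h : (chi x)^* * chi x = 1.
  by rewrite /chi xiE cisX cis_conj.
have nz : chi x != 0 by apply: contra_eq_neq h => ->; rewrite mulr0 eq_sym oner_eq0.
by rewrite chiN; apply: (mulIf nz); rewrite h mulVf.
Qed.

(** For c = 2^(k-2) and c = 2^(k-1) this turns the integer powers of i and -1 occurring in [E] into
    values of [chi]. *)
Lemma chi_int c (z : int) : chi (c * z%:~R) = chi c ^ z.
Proof.
have H n : chi (c * n%:R) = chi c ^+ n.
  elim: n => [|n IH]; first by rewrite mulr0.
  by rewrite mulrSr mulrDr mulr1 chiD IH exprSr.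
case: z => n; first exact: H.
by rewrite NegzE mulrNz mulrN chiN H.
Qed.

End Character.

(** * Action of the operators on basis vectors *)

Section Action.
Variables (K : realType) (m : nat).

Lemma tensor_ket (A : 'I_m -> 'M[K[i]%C]_2) (u v : 'rV['Z_2]_m) :
  (tensor A *m ket K v) (enum_rank u) 0 = \prod_(l < m) A l (u 0 l) (v 0 l).
Proof. by rewrite /ket -colE !mxE; under eq_bigr do rewrite !enum_rankK. Qed.

Lemma intrZ2_mod (x : int) : x%:~R = (x %% 2)%Z%:~R :> 'Z_2.
Proof.
rewrite {1}(divz_eq x 2) intrD intrM (_ : 2%:~R = 0 :> 'Z_2) ?mulr0 ?add0r //.
exact/val_inj.
Qed.

Lemma modz2_cases (x : int) : (x %% 2)%Z = 0 \/ (x %% 2)%Z = 1.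
Proof. lia. Qed.

(** In column [j], the power of Z contributes the sign and the power of X moves the only nonzero
    entry to row [j + x]. *)
Lemma pauliXZ (x y : int) (i j : 'Z_2) :
  (pauliX K ^ x * pauliZ K ^ y) i j
  = (-1) ^ (y * (j : nat)%:R) *+ (i == j + x%:~R).
Proof.
(* X, Z and the scalar (-1)^j all square to 1, so only the parities of [x] and [y] matter and four
   cases remain. *)
have mod2 (A : unitRingType) (g : A) z : g * g = 1 -> g ^ z = g ^ (z %% 2)%Z.
  by move=> gg; apply: (exprz_modM (p := 2)) => //; rewrite modz_mod.
rewrite (mod2 _ _ x (pauliX2 K)) (mod2 _ _ y (pauliZ2 K)) intrZ2_mod.
rewrite [y * _]mulrC -exprz_exp [(j : nat)%:R]natz -exprnP.
rewrite [in RHS](mod2 _ _ y) ?mulrNN -?expr2 ?sqrr_sign //.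
have [-> | ->] := modz2_cases x; have [-> | ->] := modz2_cases y;
rewrite ?expr0z ?expr1z ?mulr1 ?mul1r; rewrite ?mxE ?big_ord_recl ?big_ord0 ?mxE;
by case: i => [[|[|i]] ?] //; case: j => [[|[|j]] ?] //; rewrite -?val_eqE /=
  ?mulr0n ?mulr1n ?expr0 ?expr1 ?mulr0 ?mul0r ?mul1r ?mulr1 ?addr0 ?add0r.
Qed.

(** Each |v><v| is a diagonal matrix unit. In diagonal form the adjoint is just entrywise
    conjugation. *)
Lemma tau_diag k (R : 'M['Z_(2 ^ k)]_m) :
  tau K R = diag_mx (\row_i
    let V := liftmx 'Z_(2 ^ k) (enum_val i) in chi K ((V *m R *m V^T) 0 0)).
Proof.
rewrite diag_mx_sum_delta /tau (reindex enum_rank) /=; last first.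
  by apply: onW_bij; exact: enum_rank_bij.
apply: eq_bigr => u _; rewrite mxE enum_rankK.
by rewrite /ket trmx_delta map_delta_mx mul_delta_mx.
Qed.

Lemma diag_ket (d : 'rV[K[i]%C]_(dimN m)) (v : 'rV['Z_2]_m) :
  diag_mx d *m ket K v = d 0 (enum_rank v) *: ket K v.
Proof.
rewrite mul_diag_mx; apply/matrixP=> i j; rewrite !mxE.
by case: (i =P _) => [->|] //=; rewrite !mulr0.
Qed.

Lemma tau_ket k (R : 'M['Z_(2 ^ k)]_m) (v : 'rV['Z_2]_m) :
  let V := liftmx 'Z_(2 ^ k) v in
  tau K R *m ket K v = chi K ((V *m R *m V^T) 0 0) *: ket K v.
Proof. by rewrite tau_diag diag_ket mxE enum_rankK. Qed.

Lemma tau_adj_ket k (R : 'M['Z_(2 ^ k)]_m) (v : 'rV['Z_2]_m) : (2 <= k)%N ->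
  let V := liftmx 'Z_(2 ^ k) v in
  (tau K R)^t* *m ket K v = chi K (- (V *m R *m V^T) 0 0) *: ket K v.
Proof.
move=> hk V; rewrite tau_diag tr_diag_mx map_diag_mx diag_ket 2!mxE enum_rankK /=.
by rewrite chi_conj.
Qed.

Lemma E_ket k (x y : 'rV[int]_m) (v : 'rV['Z_2]_m) : (2 <= k)%N ->
  let red (u : 'rV[int]_m) : 'rV['Z_(2 ^ k)]_m := map_mx intr u in
  E K x y *m ket K v
  = chi K (2%:R ^+ (k - 2) * (red x *m (red y)^T) 0 0
           + 2%:R ^+ (k - 1) * (liftmx _ v *m (red y)^T) 0 0)
    *: ket K (v + digit 0 x).
Proof.
move=> hk red.
have chi_i : chi K (2%:R ^+ (k - 2) : 'Z_(2 ^ k)) = 'i%C.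
  by rewrite -natrX chi_nat // xi_quarter.
have chi_m1 : chi K (2%:R ^+ (k - 1) : 'Z_(2 ^ k)) = -1.
  by rewrite -natrX chi_nat // xi_half.
have -> : (red x *m (red y)^T) 0 0 = ((x *m y^T) 0 0)%:~R.
  rewrite !mxE rmorph_sum /=; apply: eq_bigr => l _.
  by rewrite !mxE intrM.
have -> : (liftmx _ v *m (red y)^T) 0 0 = ((y *m (liftmx int v)^T) 0 0)%:~R.
  rewrite !mxE rmorph_sum /=; apply: eq_bigr => l _.
  by rewrite !mxE intrM mulrC rmorph_nat.
rewrite chiD // !chi_int // chi_i chi_m1 -scalerA /E -scalemxAl.
(* [E] reduces the exponent of i modulo 4, whereas [chi_int] produces the full integer exponent. *)
have i4 : ('i%C : K[i]%C) ^+ 4 = 1.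
  by rewrite complexiE (exprM _ 2 2) sqrCi sqrrN expr1n.
rewrite (exprz_modM (isT : (0 < 4)%N) i4 (modz_mod _ _)); congr (_ *: _).
apply/matrixP => i j; rewrite ord1 {j} -(enum_valK i); move: (enum_val i) => {i} u.
rewrite tensor_ket; under eq_bigr do rewrite pauliXZ.
rewrite /ket !mxE eqxx andbT (inj_eq enum_rank_inj).
(* On the shifted index every tensor factor is a sign, and the signs multiply to (-1)^(y v^T). *)
have [->|] := eqVneq u (v + digit 0 x).
  rewrite mulr1.
  elim/big_ind2: _ => //= [z1 z2 c1 c2 -> ->|l _].
    by rewrite exprzDr ?unitrN1.
  by rewrite !mxE expr0 divz1 eqxx.
rewrite mulr0 => /eqP/rowP ne.
(* At any other index, a single differing coordinate makes the whole product vanish. *)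
suff [l] : exists l, u 0 l != v 0 l + (x 0 l)%:~R.
  by move=> /negbTE h; rewrite (bigD1 l) //= h mulr0n mul0r.
apply/existsP; apply: contra_notT ne => /existsPn h l.
by rewrite !mxE expr0 divz1; apply/eqP; rewrite -[_ == _]negbK h.
Qed.

End Action.

(** * The identity between exponents in Z_(2^k) *)

Section Exponent.
Variables (k m : nat).
Hypothesis hk : (2 <= k)%N.
Local Notation Zk := 'Z_(2 ^ k).
Implicit Types (x y z : 'rV[Zk]_m) (M : 'M[Zk]_m) (a : 'rV[int]_m).

(** Dot products are the case [M = 1%:M], so one set of bilinearity rules expands every term of the
    exponents. *)
Definition form M x y : Zk := (x *m M *m y^T) 0 0.

Lemma formDl M x y z : form M (x + y) z = form M x z + form M y z.
Proof. by rewrite /form !mulmxDl mxE. Qed.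

Lemma formDr M x y z : form M x (y + z) = form M x y + form M x z.
Proof. by rewrite /form linearD /= mulmxDr mxE. Qed.

Lemma formZl M c x y : form M (c *: x) y = c * form M x y.
Proof. by rewrite /form -!scalemxAl mxE. Qed.

Lemma formZr M c x y : form M x (c *: y) = c * form M x y.
Proof. by rewrite /form linearZ /= -scalemxAr mxE. Qed.

Lemma formNl M x y : form M (- x) y = - form M x y.
Proof. by rewrite /form !mulNmx mxE. Qed.

Lemma formNr M x y : form M x (- y) = - form M x y.
Proof. by rewrite /form linearN mulmxN mxE. Qed.

Lemma form_sym M x y : M^T = M -> form M x y = form M y x.
Proof.
move=> hM; rewrite /form -[in LHS](trmxK (_ *m _)) mxE.
by rewrite !trmx_mul trmxK hM mulmxA.
Qed.

Lemma form_mul M x y : (x *m (y *m M)^T) 0 0 = form M^T x y.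
Proof. by rewrite /form trmx_mul mulmxA. Qed.

Lemma form1E x y : (x *m y^T) 0 0 = form 1%:M x y.
Proof. by rewrite /form mulmx1. Qed.

Lemma intr_liftmx x : map_mx intr (liftmx int x) = x.
Proof. by apply/rowP => l; rewrite !mxE rmorph_nat natr_Zp. Qed.

(** Bits are smaller than 2^k, so they survive the passage through residues. Hence E(a,b) and E(a_0,
    b_0 + a_0 R) shift [v] to the same basis vector. *)
Lemma digit0_liftmx (w : 'rV['Z_2]_m) : digit 0 (liftmx int (liftmx Zk w)) = w.
Proof.
apply/rowP => l; rewrite !mxE expr0 divz1 rmorph_nat.
rewrite val_Zp_nat ?modulus_gt1 // modn_small ?natr_Zp //.
by apply: leq_trans (ltn_ord _) (modulus_gt1 hk).
Qed.

(** Two digits suffice: in the exponents the remainder [4 *: c] always meets a factor 2^(k-2), and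
    the product vanishes modulo 2^k. *)
Lemma intr_digits a : exists c,
  map_mx intr a = liftmx Zk (digit 0 a) + 2 *: liftmx Zk (digit 1 a) + 4 *: c.
Proof.
pose s l : int := \sum_(j < 2) 2 ^+ j * liftmx int (digit j a) 0 l.
(* The division is exact, by the digit expansion modulo 2^2. *)
exists (\row_l ((a 0 l - s l)%R %/ 4)%Z%:~R).
apply/rowP => l; have /= /eqP := digit_expansion 2 a l.
rewrite -/(s l) eqz_mod_dvd => /divzK h.
have sE : (s l)%:~R = (liftmx Zk (digit 0 a) + 2 *: liftmx Zk (digit 1 a)) 0 l.
  rewrite /s !big_ord_recl big_ord0 addr0 expr0 expr1 mul1r.
  by rewrite !mxE intrD intrM !rmorph_nat.
rewrite [in RHS]mxE -sE !mxE -{1}[a 0 l](subrK (s l)) -{1}h intrD intrM addrC.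
by rewrite [_ * (2 ^+ 2)%:~R]mulrC.
Qed.

(** For bits s and t, the sum modulo 2 is the integer s + t - 2st. *)
Lemma liftmxD (u w : 'rV['Z_2]_m) :
  liftmx Zk (u + w)
  = liftmx Zk u + liftmx Zk w - 2 *: star (liftmx Zk u) (liftmx Zk w).
Proof.
apply/rowP => l; rewrite !mxE.
case: (u 0 l) => [[|[|i]] ?] //; case: (w 0 l) => [[|[|j]] ?] //=.
all: by [ rewrite (_ : (_ %% _)%N = 0%N) //; ring
        | rewrite (_ : (_ %% _)%N = 1%N) //; ring ].
Qed.

Lemma quarter_mul4 : 2 ^+ (k - 2) * 4 = 0 :> Zk.
Proof.
rewrite -[4]/((2 ^ 2)%:R) -natrX -natrM -expnD subnK //.
by rewrite pchar_Zp ?modulus_gt1.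
Qed.

Lemma halfE : 2 ^+ (k - 1) = 2 ^+ (k - 2) * 2 :> Zk.
Proof. by rewrite -exprSr; congr (_ ^+ _); lia. Qed.

(** The left side collects the phases of [tau], [E] and the adjoint of [tau] along |v>; the right
    side adds the phase of E(a_0, b_0 + a_0 R) to [q]. With W = V + a_0 - 2S, symmetry of R makes
    the terms of W R W^T involving S add up to -4 [eta]. *)
Lemma exponent_identity (R : 'M[Zk]_m) (hR : R^T = R) (v : 'rV['Z_2]_m)
    (a b : 'rV[int]_m) :
  let V := liftmx Zk v in
  let W := liftmx Zk (v + digit 0 a) in
  let a0 := liftmx Zk (digit 0 a) in
  let b0 := liftmx Zk (digit 0 b) in
  let red (u : 'rV[int]_m) : 'rV[Zk]_m := map_mx intr u in
  (W *m R *m W^T) 0 0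
  + (2 ^+ (k - 2) * (red a *m (red b)^T) 0 0
     + 2 ^+ (k - 1) * (V *m (red b)^T) 0 0)
  - (V *m R *m V^T) 0 0
  = q v R a b + (2 ^+ (k - 2) * (a0 *m (b0 + a0 *m R)^T) 0 0
                 + 2 ^+ (k - 1) * (V *m (b0 + a0 *m R)^T) 0 0).
Proof.
move=> V W a0 b0 red.
have [c ac] := intr_digits a; have [d bd] := intr_digits b.
rewrite /W liftmxD /q /eta /red ac bd -/V -/a0 -/b0.
set a1 := liftmx Zk (digit 1 a); set b1 := liftmx Zk (digit 1 b).
set S := star V a0.
have hb x : (x *m (b0 + a0 *m R)^T) 0 0 = form 1%:M x b0 + form R x a0.
  by rewrite linearD /= mulmxDr mxE form_mul hR form1E.
have hab : (a0 *m b1^T + b0 *m a1^T) 0 0 = form 1%:M a0 b1 + form 1%:M a1 b0.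
  by rewrite mxE !form1E (form_sym b0) ?trmx1.
have formE M x y : (x *m M *m y^T) 0 0 = form M x y by [].
rewrite !hb hab !formE !form1E.
rewrite !(formDl, formDr, formNl, formNr, formZl, formZr).
(* Each mixed term gets a single orientation, so that [ring] can treat the remaining values of
   [form] as atoms. *)
rewrite (form_sym a0 V) // (form_sym S V) // (form_sym S a0) // halfE.
set h := 2 ^+ (k - 2).
apply/eqP; rewrite -subr_eq0; apply/eqP.
set f := form 1%:M.
(* The two sides agree up to multiples of 2^(k-2) * 4 = 2^k. *)
transitivity (h * 4 * (f c b0 + 2 * f c b1 + 4 * f c d + f a0 d + f a1 b1
  + 2 * f a1 d + f V b1 + 2 * f V d - form R V a0)); last first.
  by rewrite quarter_mul4 mul0r.
ring.
Qed.


End Exponent.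

Theorem lemma3 (K : realType) (m k : nat) (hm : (1 <= m)%N) (hk : (2 <= k)%N)
    (R : 'M['Z_(2 ^ k)]_m) (hR : R^T = R) (v : 'rV['Z_2]_m)
    (a b : 'rV[int]_m) :
  let a0 := liftmx 'Z_(2 ^ k) (digit 0 a) in
  let b0 := liftmx 'Z_(2 ^ k) (digit 0 b) in
  (tau K R *m E K a b *m (tau K R)^t*) *m ket K v
    = xi K k ^+ q v R a b *: (Erow K (row_mx a0 b0 *m Gamma R) *m ket K v)
  /\
  xi K k ^+ q v R a b *: (Erow K (row_mx a0 b0 *m Gamma R) *m ket K v)
    = xi K k ^+ q v R a b *: (Emod K a0 (b0 + a0 *m R) *m ket K v).
Proof.
move=> a0 b0.
have -> : Erow K (row_mx a0 b0 *m Gamma R) = Emod K a0 (b0 + a0 *m R).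
  by rewrite /Erow mul_row_block !mulmx1 mulmx0 addr0 row_mxKl row_mxKr addrC.
split=> //; rewrite -!mulmxA tau_adj_ket // -!scalemxAr (E_ket K _ _ _ hk).
(* Here [tau] acts on the shifted vector v + a_0, whose phase is the W R W^T of
   [exponent_identity]. *)
rewrite -!scalemxAr tau_ket /Emod (E_ket K _ _ _ hk) !intr_liftmx digit0_liftmx //.
rewrite -[xi K k ^+ _]/(chi K (q v R a b)) !scalerA -!chiD //.
by congr (chi _ _ *: _); rewrite -exponent_identity //; ring.
Qed.
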